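(* Let $G$ be a finite group, and suppose that $\mathrm{AD}(G)\leq 2$. Then $\mathrm{AD}(G)\in\{2-n^{-1} : n\in\mathbb{N}\}$.
   Context: For a finite group $G$, $\mathrm{Irr}(G)$ denotes the set of irreducible complex characters of $G$, and $d(\varphi)$ denotes the degree of a character $\varphi$. The Fourier anti-diagonal constant of $G$ is given by the formula $\mathrm{AD}(G)=\frac{1}{|G|}\sum_{\varphi\in\mathrm{Irr}(G)} d(\varphi)^3$ (this is known to equal the Fourier norm of the subset $\{(g,g^{-1}): g\in G\}$ of $G\times G$; the formula may be taken as the definition). $\mathbb{N}=\{1,2,3,\dots\}$. *)

(* Defs.v *)
From mathcomp Require Import all_boot all_order all_algebra all_fingroup all_field all_character.

Set Implicit Arguments.
Unset Strict Implicit.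
Unset Printing Implicit Defensive.

Import Order.TTheory GRing.Theory Num.Theory.
Local Open Scope ring_scope.

(* The values of complex characters of a finite group are algebraic numbers,
   so irr G (with values in algC) lists all of Irr(G). *)
Definition AD (gT : finGroupType) (G : {group gT}) : algC :=
  #|G|%:R^-1 * \sum_(i : Iirr G) ('chi[G]_i 1%g) ^+ 3.

(* Main.v *)
Require Import Defs.
From mathcomp Require Import all_boot all_order all_algebra all_fingroup all_solvable all_field all_character.

Import Order.TTheory GRing.Theory Num.Theory.
Local Open Scope ring_scope.

(** Write [d] for the degree of an irreducible character and [G'] for the
derived subgroup.  Since the squares [d ^ 2] add up to [|G|], the constant
[AD G] is the mean of [d] for the Plancherel measure, and if every [d] is at
most 2 the identity [d ^ 3 = 2 * d ^ 2 - (d == 1)] gives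
[AD G = 2 - |G : G'| / |G| = 2 - 1 / |G'|].  The point is therefore that
[AD G <= 2] forbids characters of degree at least 3 ([deg_le2]).

Suppose that [chi_i] has degree at least 3 and let the [|G : G'|] linear
characters act on it by multiplication.  The number [m_j] of linear [xi] with
[xi * chi_i = chi_j] is at most [d_j ^ 2], because each such [xi] is a
constituent of [chi_j * chi_i^*] ([card_twistors_le]), and [m_j] vanishes
unless [d_j = d_i].  Hence [2 * d_j ^ 2 + m_j <= d_j ^ 3 + (d_j == 1)] for
every [j] ([twistors_bound]).  On summing over [j], the terms [m_j] on the left
and [(d_j == 1)] on the right both contribute [|G : G'|], and what remains is
[2 * |G| <= |G| * AD G].  So [AD G <= 2] forces equality for every [j]
([twistors_eq]).

Equality at [j = i] gives [d_i = 3] and [m_i = 9]: the character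
[chi_i * chi_i^*] is a sum of nine linear characters, so [|chi_i| = 3] on [G'],
that is, [G'] acts by scalars ([norm_irr_der1]).  Equality at the dual of
[chi_i] shows that [chi_i^*] is a linear twist of [chi_i], so these scalars are
real, hence signs; their cubes are values on [G'] of the determinant, hence 1.
Thus [G'] acts trivially ([der1_sub_ker_real]) and [chi_i] would be linear. *)

Section CharacterLemmas.

Context {gT : finGroupType} {G : {group gT}}.
Implicit Types (phi chi xi : 'CF(G)) (i j l : Iirr G).

(** Distinct irreducible constituents can be subtracted all at once; evaluating
the difference at 1 then bounds the sum of their degrees, and when that bound
is attained the difference is the zero character. *)
Lemma sub_sum_constt_char chi (A : {set Iirr G}) :
  chi \is a character -> {subset A <= irr_constt chi} ->
  chi - \sum_(i in A) 'chi_i \is a character.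
Proof.
move=> Nchi sA; apply/forallP=> i; rewrite coord_cfdot cfdotBl cfdot_suml.
have -> : \sum_(j in A) '['chi_j, 'chi_i] = (i \in A)%:R.
  rewrite (eq_bigr (fun j => (j == i)%:R)) => [|j _]; last by rewrite cfdot_irr.
  case: (boolP (i \in A)) => Ai.
    by rewrite (bigD1 i) //= eqxx big1 ?addr0 // => j /andP[_ /negbTE->].
  by rewrite big1 // => j Aj; case: eqP Ai => // <-; rewrite Aj.
case: (boolP (i \in A)) => [/sA | _]; last by rewrite subr0 Cnat_cfdot_char_irr.
rewrite irr_consttE; case/natrP: (Cnat_cfdot_char_irr i Nchi) => n ->.
by rewrite pnatr_eq0 -lt0n => /natrB <-; apply: rpred_nat.
Qed.

Lemma cfdot_mul_conjC chi phi xi : '[chi * phi^*%CF, xi] = '[chi, xi * phi].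
Proof.
rewrite !cfdotE; congr (_ * _); apply: eq_bigr => x _.
by rewrite !cfunE rmorphM -mulrA [_^* * _]mulrC.
Qed.

Lemma linear_irrE i :
  ('chi_i \is a linear_char) = (irr_degree (socle_of_Iirr i) == 1)%N.
Proof. by rewrite qualifE/= irr_char irr1_degree pnatr_eq1. Qed.

(** The target is tested through [cfIirr] so that, for fixed [i], the sets
[twistors i j] are the fibres of one function on the linear characters. *)
Definition twistors i j : {set Iirr G} :=
  [set l | ('chi_l \is a linear_char) && (cfIirr ('chi_l * 'chi_i) == j)].

Lemma twistorsP i j l :
  l \in twistors i j -> 'chi_l \is a linear_char /\ 'chi_l * 'chi_i = 'chi_j.
Proof.
rewrite inE => /andP[Ll /eqP<-]; split=> //.
by rewrite cfIirrE // mul_lin_irr ?mem_irr.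
Qed.

(** By adjunction, the multiplicity of [chi_l] in [chi_j * chi_i^*] is the inner
product of [chi_j] with [chi_l * chi_i], which is [chi_j] itself. *)
Lemma twistors_constt i j :
  {subset twistors i j <= irr_constt ('chi_j * ('chi_i)^*%CF)}.
Proof.
move=> l /twistorsP[_ Dj].
by rewrite irr_consttE cfdot_mul_conjC Dj cfnorm_irr oner_eq0.
Qed.

Lemma sum_twistors1 i j :
  \sum_(l in twistors i j) 'chi_l 1%g = #|twistors i j|%:R.
Proof.
rewrite -sumr_const; apply: eq_bigr => l /twistorsP[Ll _].
exact: lin_char1.
Qed.

Lemma mul_conjC_irr_char i j : 'chi_j * ('chi_i)^*%CF \is a character.
Proof. by rewrite rpredM ?irr_char // -conjC_IirrE irr_char. Qed.

Lemma mul_conjC_irr1 i j :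
  ('chi_j * ('chi_i)^*%CF) 1%g = 'chi_j 1%g * 'chi_i 1%g.
Proof. by rewrite -(cfConjC_irr1 Num.conj i) cfunE. Qed.

Lemma card_twistors_le i j :
  #|twistors i j|%:R <= 'chi_j 1%g * 'chi_i 1%g.
Proof.
have := sub_sum_constt_char _ _ (mul_conjC_irr_char i j) (@twistors_constt i j).
move/char1_ge0; rewrite cfunE mul_conjC_irr1 cfunE sum_cfunE.
by rewrite sum_twistors1 subr_ge0.
Qed.

Lemma twistor_degree i j l : l \in twistors i j -> 'chi_j 1%g = 'chi_i 1%g.
Proof. by case/twistorsP=> Ll <-; rewrite cfunE lin_char1 ?mul1r. Qed.

(** Every linear character sends [chi_i] to exactly one irreducible
character. *)
Lemma sum_card_twistors i : (\sum_j #|twistors i j| = #|G : G^`(1)|%g)%N.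
Proof.
rewrite -card_lin_irr -sum1_card.
rewrite [RHS](partition_big (fun l => cfIirr ('chi_l * 'chi_i)) xpredT) //=.
by apply: eq_bigr => j _; rewrite sum1dep_card.
Qed.

(** If the stabiliser of [chi_i] under twisting has the maximal order
[chi_i(1) ^ 2], then [chi_i * chi_i^*] is the sum of the linear characters in
it, and each of these is 1 on the derived subgroup. *)
Lemma norm_irr_der1 i x :
    #|twistors i i|%:R = 'chi_i 1%g ^+ 2 -> x \in G^`(1)%g ->
  `|'chi_i x| = 'chi_i 1%g.
Proof.
move=> full G'x; have Gx : x \in G := subsetP (der_sub 1 G) x G'x.
have Nrest := sub_sum_constt_char _ _ (mul_conjC_irr_char i i)
  (@twistors_constt i i).
have := char1_eq0 Nrest.
rewrite cfunE mul_conjC_irr1 cfunE sum_cfunE sum_twistors1 full.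
rewrite -expr2 subrr eqxx.
move/esym; rewrite subr_eq0 => /eqP/cfunP/(_ x).
rewrite sum_cfunE !cfunE -normCK (eq_bigr (fun=> 1)); last first.
  by move=> l /twistorsP[Ll _]; rewrite cfker1 ?lin_char1 ?(subsetP (lin_char_der1 Ll)).
rewrite sumr_const full => /eqP; rewrite eqrXn2 ?char1_ge0 ?irr_char //.
by move/eqP.
Qed.

(** An element [x] of the derived subgroup acts as a scalar [c] of modulus 1.
The relation [chi_i^* = xi * chi_i] with [xi] linear makes [c] real, so
[c ^ 2 = 1], while the determinant, being linear, gives [c ^ d = 1]; for odd
[d] these force [c = 1]. *)
Lemma der1_sub_ker_real i l :
    odd (irr_degree (socle_of_Iirr i)) ->
    {in G^`(1)%g, forall x, `|'chi_i x| = 'chi_i 1%g} ->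
    l \in twistors i (conjC_Iirr i) -> G^`(1)%g \subset cfker 'chi_i.
Proof.
set d := irr_degree _ => odd_d normG' /twistorsP[Ll Dconj].
apply/subsetP=> x G'x; have Gx : x \in G := subsetP (der_sub 1 G) x G'x.
have [|c normc rhoc] := @max_cfRepr_norm_scalar _ _ _ 'Chi_i x Gx.
  by rewrite irrRepr normG' // irr1_degree.
have d_neq0 : d%:R != 0 :> algC by rewrite -irr1_degree irr1_neq0.
have chi_x : 'chi_i x = c * d%:R.
  by rewrite -irrRepr cfunE Gx rhoc mxtrace_scalar mulr_natr.
have real_c : c^* = c.
  have := congr1 (fun xi : 'CF(G) => xi x) Dconj.
  rewrite conjC_IirrE cfConjCE cfunE cfker1 ?(subsetP (lin_char_der1 Ll)) //.
  rewrite lin_char1 // mul1r chi_x rmorphM rmorph_nat.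
  by move/(mulIf d_neq0).
have c2 : c ^+ 2 = 1 by rewrite expr2 -{2}real_c -normCK normc expr1n.
have cd : c ^+ d = 1.
  have Ldet : detRepr 'Chi_i \is a linear_char := detRepr_lin_char _.
  rewrite -det_scalar -rhoc -(lin_char1 Ldet).
  rewrite -(cfker1 (subsetP (lin_char_der1 Ldet) x G'x)).
  by rewrite cfunE Gx trace_mx11 mxE eqxx.
have c1 : c = 1.
  by move: cd; rewrite -(odd_double_half d) odd_d -mul2n exprS exprM c2 expr1n mulr1.
by rewrite cfkerEirr inE chi_x c1 mul1r irr1_degree.
Qed.

End CharacterLemmas.

Section Degrees.

Context {gT : finGroupType} {G : {group gT}}.

Local Notation deg i := (irr_degree (socle_of_Iirr i)).

Lemma sum_deg_sq : (\sum_(i : Iirr G) deg i ^ 2 = #|G|)%N.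
Proof.
apply/eqP; rewrite -(eqr_nat algC) -irr_sum_square natr_sum.
by apply/eqP/eq_bigr => i _; rewrite irr1_degree natrX.
Qed.

Lemma AD_deg : AD G = #|G|%:R^-1 * (\sum_(i : Iirr G) deg i ^ 3)%N%:R.
Proof.
rewrite /AD natr_sum; congr (_ * _); apply: eq_bigr => i _.
by rewrite irr1_degree natrX.
Qed.

Lemma sum_linear : (\sum_(i : Iirr G) (deg i == 1) = #|G : G^`(1)|%g)%N.
Proof.
rewrite -card_lin_irr -sum1_card [RHS]big_mkcond.
by apply: eq_bigr => i _; rewrite inE /= linear_irrE; case: eqP.
Qed.

(** For [d] in {1, 2} one has [d ^ 3 + (d == 1) = 2 * d ^ 2]; sum over all
irreducible characters. *)
Lemma AD_deg_le2 :
  (forall i : Iirr G, (deg i <= 2)%N) -> AD G = 2 - #|G^`(1)%g|%:R^-1.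
Proof.
move=> deg2.
have cube (i : Iirr G) : (deg i ^ 3 + (deg i == 1) = 2 * deg i ^ 2)%N.
  move: (deg2 i) (irr_degree_gt0 (socle_of_Iirr i)).
  by case: (irr_degree _) => [|[|[|]]].
have sum3 : (\sum_(i : Iirr G) deg i ^ 3 + #|G : G^`(1)|%g = 2 * #|G|)%N.
  rewrite -sum_linear -sum_deg_sq -big_split big_distrr.
  by apply: eq_bigr => i _; apply: cube.
have idx : #|G : G^`(1)|%g%:R = #|G|%:R / #|G^`(1)%g|%:R :> algC.
  by rewrite -(Lagrange (der_sub 1 G)) natrM mulrAC divff ?mul1r ?neq0CG.
have := congr1 (fun n => n%:R : algC) sum3.
rewrite natrD natrM idx => /(canRL (addrK _)); rewrite AD_deg => ->.
by rewrite mulrBr mulrCA mulVf ?neq0CG // mulr1 mulrA mulVf ?neq0CG // mul1r.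
Qed.

Lemma twistors_le_sqr i j : (#|@twistors gT G i j| <= deg j ^ 2)%N.
Proof.
have [-> // | [l Tl]] := set_0Vmem (twistors i j); first by rewrite cards0.
rewrite -(ler_nat algC) natrX -irr1_degree expr2.
by rewrite {2}(twistor_degree _ _ _ Tl) card_twistors_le.
Qed.

(** Without twistors this is [2 * d ^ 2 <= d ^ 3 + (d == 1)], true for all
[d > 0].  With twistors [d] is also the degree of [chi_i], so [d >= 3], and
their number is at most [d ^ 2]. *)
Lemma twistors_bound i j : (2 < deg i)%N ->
  (2 * deg j ^ 2 + #|@twistors gT G i j| <= deg j ^ 3 + (deg j == 1))%N.
Proof.
move=> deg_i; have deg_j := irr_degree_gt0 (socle_of_Iirr j).
have [T0 | [l Tl]] := set_0Vmem (twistors i j).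
  rewrite T0 cards0 addn0.
  case: (deg j) deg_j => [|[|e]] // _; rewrite expnS.
  exact: leq_trans (leq_mul _ _) (leq_addr _ _).
have deg_ji : deg j = deg i.
  by apply/eqP; rewrite -(eqr_nat algC) -!irr1_degree (twistor_degree _ _ _ Tl).
apply: leq_trans (leq_add (leqnn _) (twistors_le_sqr i j)) _.
apply: leq_trans (leq_addr _ _).
by rewrite -mulSnr (expnS _ 2) leq_mul ?deg_ji.
Qed.

(** Summed over [j], [twistors_bound] reads [2 * |G| <= |G| * AD G]; the
hypothesis is the reverse inequality, so each summand is an equality. *)
Lemma twistors_eq i j : AD G <= 2 -> (2 < deg i)%N ->
  (2 * deg j ^ 2 + #|@twistors gT G i j| = deg j ^ 3 + (deg j == 1))%N.
Proof.
rewrite AD_deg ler_pdivrMl ?gt0CG // -natrM ler_nat mulnC => hAD deg_i.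
have leS := leqif_sum (fun k (_ : xpredT k) => leqif_eq (twistors_bound i k deg_i)).
apply/eqP; move: j; apply/forallP; rewrite -leS.2 eqn_leq leS.1 /=.
by rewrite 2!big_split /= -big_distrr sum_card_twistors sum_linear sum_deg_sq leq_add2r.
Qed.

(** A character of degree at least 3 saturates every [twistors_bound]; taking
[j = i], and [j] the dual of [i], provides the hypotheses of [norm_irr_der1] and
[der1_sub_ker_real], which make the character linear. *)
Lemma deg_le2 (i : Iirr G) : AD G <= 2 -> (deg i <= 2)%N.
Proof.
move=> hAD; rewrite leqNgt; apply/negP=> deg_i.
have eqT := twistors_eq i _ hAD deg_i.
(* At j = i, with d the degree: d ^ 3 = 2 * d ^ 2 + m_i <= 3 * d ^ 2. *)
have deg3 : deg i = 3.
  have := twistors_le_sqr i i; rewrite -(leq_add2l (2 * deg i ^ 2)) eqT.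
  rewrite -mulSnr expnS.
  move: deg_i; case: (deg i) => [|[|[|[|e]]]] //= _.
  by rewrite addn0 leq_pmul2r.
have card_ii : #|twistors i i| = 9%N by have := eqT i; rewrite deg3 => /addnI.
(* The dual character also has degree 3, so it has 27 - 18 = 9 twistors. *)
have [l Tl] : exists l, l \in twistors i (conjC_Iirr i).
  apply/card_gt0P.
  have deg_c : deg (conjC_Iirr i) = 3.
    apply/eqP; rewrite -deg3 -(eqr_nat algC) -!irr1_degree.
    by rewrite conjC_IirrE (cfConjC_irr1 Num.conj).
  by have := eqT (conjC_Iirr i); rewrite deg_c => /addnI->.
have : G^`(1)%g \subset cfker 'chi_i.
  apply: der1_sub_ker_real Tl => [|x]; first by rewrite deg3.
  by apply: norm_irr_der1; rewrite card_ii irr1_degree deg3 -natrX.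
by rewrite -lin_irr_der1 linear_irrE deg3.
Qed.

End Degrees.

Theorem theorem1p2 (gT : finGroupType) (G : {group gT}) (hG : AD G <= 2) :
  exists n : nat, (0 < n)%N /\ AD G = 2 - n%:R^-1.
Proof.
exists #|G^`(1)%g|; split; first exact: cardG_gt0.
by apply: AD_deg_le2 => i; apply: deg_le2.
Qed.
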